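(* Let $n\ge 2$ and let $\mathcal{C}$ be an idempotent clone over $E_n=\{0,\dots,n-1\}$ such that (1) for every prime $p\le n$, $\mathcal{C}$ contains a cyclic operation of arity $p$, and (2) $\mathcal{C}$ contains a Mal'cev operation. Then $\mathcal{C}$ contains a majority operation.
   Context: A clone over $E_n$ is a set of finitary operations $E_n^k\to E_n$ ($k\ge 1$) that contains all projections and is closed under composition. It is idempotent if every operation $f$ in it satisfies $f(x,\dots,x)=x$ for all $x\in E_n$. A $p$-ary operation $c$ is cyclic if $c(x_1,x_2,\dots,x_p)=c(x_2,\dots,x_p,x_1)$ for all $x_1,\dots,x_p$. A Mal'cev operation is a ternary operation $m$ with $m(x,y,y)=m(y,y,x)=x$ for all $x,y$. A majority operation is a ternary operation $m$ with $m(x,y,y)=m(y,x,y)=m(y,y,x)=y$ for all $x,y$. *)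

(* Defs.v *)
From mathcomp Require Import all_boot.
Set Implicit Arguments. Unset Strict Implicit. Unset Printing Implicit Defensive.

(* k-ary operations on E_n = 'I_n; finite functions, so that operations that
   agree pointwise are equal. *)
Definition operation (n k : nat) := {ffun k.-tuple 'I_n -> 'I_n}.

Definition projection (n k : nat) (i : 'I_k) : operation n k :=
  [ffun x => tnth x i].

Definition composition (n k m : nat)
    (f : operation n k) (g : 'I_k -> operation n m) : operation n m :=
  [ffun x => f [tuple g i x | i < k]].

(* A set of operations is given arity by arity. Only arities k >= 1 count: no
   condition below ever mentions C 0. *)
Definition operation_set (n : nat) := forall k : nat, operation n k -> Prop.

Record is_clone (n : nat) (C : operation_set n) : Prop := IsClone {
  clone_projection : forall (k : nat) (i : 'I_k), C k (projection n i);
  clone_composition : forall (k m : nat), 0 < k -> 0 < m ->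
    forall (f : operation n k) (g : 'I_k -> operation n m),
    C k f -> (forall i, C m (g i)) -> C m (composition f g)
}.

Definition idempotent_operation (n k : nat) (f : operation n k) : Prop :=
  forall x : 'I_n, f [tuple x | i < k] = x.

Definition idempotent_set (n : nat) (C : operation_set n) : Prop :=
  forall k : nat, 0 < k -> forall f : operation n k,
    C k f -> idempotent_operation f.

Definition cyclic_operation (n p : nat) (f : operation n p) : Prop :=
  forall x : p.-tuple 'I_n, f x = f [tuple of rot 1 x].

Definition maltsev_operation (n : nat) (f : operation n 3) : Prop :=
  forall x y : 'I_n, f [tuple x; y; y] = x /\ f [tuple y; y; x] = x.

Definition majority_operation (n : nat) (f : operation n 3) : Prop :=
  forall x y : 'I_n,
    [/\ f [tuple x; y; y] = y, f [tuple y; x; y] = y & f [tuple y; y; x] = y].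

(* Main.v *)
Require Import Defs.
From HB Require Import structures.
From mathcomp Require Import all_boot.
From mathcomp Require Import ssralg finalg.
From mathcomp Require Import boolp.
Set Implicit Arguments. Unset Strict Implicit. Unset Printing Implicit Defensive.

(** Cyclic operations of prime arity exclude affine behaviour, and for Mal'cev
    clones affine behaviour is the only obstacle to a majority operation.

    The reduction is Baker and Pixley's. Any two of the argument triples that a
    majority operation must handle are handled by one projection, so it is
    enough that finitely many prescribed values can be interpolated by the clone
    as soon as any two of them can ([interpolation]). Idempotence lets all but
    three of the prescriptions be fixed, and what remains is a property of
    invariant ternary relations: if (a1, a2, b3), (a1, b2, a3) and (b1, a2, a3)
    belong to R, so does (a1, a2, a3) ([invariant3_decomposable]).

    Read R as the graph of a partial multiplication z = x * y. By the Mal'cev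
    operation m it is well defined modulo the congruence th of sharing a
    factorization: z and z' are th-related when (x, y, z) and (x, y, z') lie in R
    for some x, y. The values that lie both on the row of a1 and on the column
    of a2 form a subalgebra D, containing a3 and b3, over which R is a Latin
    square modulo th. On a Latin square m is computed by completing a rectangle,
    whence m commutes with all operations of the clone on D modulo th. If b3 is
    th-related to a3, one application of m to R yields (a1, a2, a3).

    It remains to see that the quotient of D by th is trivial
    ([commuting_section_trivial]). A Mal'cev operation commuting with itself
    makes it an abelian group under x + y = m(x, e, y). A cyclic operation f of
    arity p that commutes with m is additive, so that x = f(x, ..., x) is the sum
    of p equal elements f(x, 0, ..., 0). The group is thus divisible by every
    prime up to its order N, hence by N; but N kills the group. *)

(** * Finite abelian groups and commuting operations *)

(** Translation by x permutes G, hence preserves the sum of all elements. *)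
Lemma mulrn_card (G : finZmodType) (x : G) : (x *+ #|G| = 0)%R.
Proof.
apply: (@GRing.addIr _ (\sum_(g : G) g)%R); rewrite GRing.add0r.
rewrite [RHS](reindex_inj (@GRing.addrI G x)) big_split /=.
by rewrite GRing.sumr_const.
Qed.

(** Dividing by the prime factors of N = #|G| in turn makes every element a
    multiple of N, and N annihilates G. *)
Lemma divisible_trivial (G : finZmodType) :
  (forall p, prime p -> p <= #|G| -> forall x : G, exists y, x = (y *+ p)%R) ->
  forall x : G, x = 0%R.
Proof.
move=> divp.
suff divN N : 0 < N -> (forall p, prime p -> p %| N -> p <= #|G|) ->
    forall x : G, exists y, x = (y *+ N)%R.
  have G0 : 0 < #|G| by apply/card_gt0P; exists 0%R.
  move=> x; have [|y ->] := divN _ G0 _ x; last exact: mulrn_card.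
  by move=> p _; apply: dvdn_leq.
elim/ltn_ind: N => N IH N0 pN x.
have [N1|N1] := leqP N 1.
  by exists x; have -> : N = 1 by apply/eqP; rewrite eqn_leq N1 N0.
have pr := pdiv_prime N1; have dv := pdiv_dvd N.
have [y ->] := divp _ pr (pN _ pr dv) x.
have [||p pp pd|z ->] := IH (N %/ pdiv N) _ _ _ y.
- by rewrite ltn_Pdiv // prime_gt1.
- by rewrite divn_gt0 ?pdiv_gt0 // dvdn_leq.
- by apply: pN => //; apply: dvdn_trans pd (dvdn_div dv).
by exists z; rewrite -GRing.mulrnA divnK.
Qed.

(** The constant family x is the sum of its p one-point restrictions, which f
    sends to a common value because f is cyclic. *)
Lemma cyclic_additive_divisible (G : zmodType) (p : nat)
    (f : ('I_p -> G) -> G) :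
  0 < p -> (forall x, f (fun=> x) = x) ->
  (forall v, f (v \o @ordS p) = f v) ->
  (forall v w, f (fun i => v i + w i)%R = (f v + f w)%R) ->
  forall x : G, exists y, x = (y *+ p)%R.
Proof.
move=> p0 fid fcyc fadd x.
have fsum (r : seq 'I_p) (v : 'I_p -> 'I_p -> G) :
    f (fun i => \sum_(j <- r) v j i)%R = (\sum_(j <- r) f (v j))%R.
  elim: r => [|j r IH].
    rewrite big_nil -[RHS]fid; congr f.
    by apply: funext => i; rewrite big_nil.
  rewrite big_cons -IH -fadd; congr f.
  by apply: funext => i; rewrite big_cons.
pose u (j i : 'I_p) : G := if i == j then x else 0%R.
have uS j : f (u (ordS j)) = f (u j).
  rewrite -fcyc; congr f; apply: funext => i /=.
  by rewrite /u (inj_eq (@ordS_inj p)).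
pose o := Ordinal p0.
have uE k (kp : k < p) : f (u (Ordinal kp)) = f (u o).
  elim: k kp => [|k IH] kp; first by congr (f (u _)); apply: val_inj.
  rewrite -[RHS](IH (ltnW kp)) -[RHS]uS; congr (f (u _)).
  apply: val_inj => /=.
  by rewrite modn_small.
exists (f (u o)).
have -> : (f (u o) *+ p = \sum_(j <- index_enum 'I_p) f (u j))%R.
  rewrite (eq_bigr (fun=> f (u o))); last by case=> k kp _; apply: uE.
  by rewrite GRing.sumr_const card_ord.
rewrite -fsum -[LHS]fid; congr f; apply: funext => i.
by rewrite /u -big_mkcond /= (big_pred1 i) // => j; rewrite eq_sym.
Qed.

(** The medial law for m and the two Mal'cev identities turn x + y = m x e y
    into an abelian group law with zero e and opposite m e x e, for any base
    point e. *)
Lemma commuting_maltsev_cyclic_trivial (T : finType) (m : T -> T -> T -> T) :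
  (forall x y, m x y y = x) -> (forall x y, m y y x = x) ->
  (forall x1 x2 x3 y1 y2 y3 z1 z2 z3,
     m (m x1 x2 x3) (m y1 y2 y3) (m z1 z2 z3) =
     m (m x1 y1 z1) (m x2 y2 z2) (m x3 y3 z3)) ->
  (forall p, prime p -> p <= #|T| -> exists f : ('I_p -> T) -> T,
     [/\ forall x, f (fun=> x) = x,
         forall x, f (x \o @ordS p) = f x
       & forall x y z, f (fun i => m (x i) (y i) (z i)) =
                       m (f x) (f y) (f z)]) ->
  forall x y : T, x = y.
Proof.
move=> mxyy myyx mm cyc x e.
pose add a b := m a e b; pose opp a := m e a e.
have add0 : left_id e add by move=> a; rewrite /add myyx.
have addC : commutative add.
  move=> a b; have := mm e e a e e e b e e.
  by rewrite /add !myyx !mxyy.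
have addA : associative add.
  move=> a b c; have := mm a e e e e e b e c.
  by rewrite /add !mxyy !myyx.
have addN : left_inverse e opp add.
  move=> a; have := mm e a e e e e e e a.
  by rewrite /add /opp !mxyy !myyx !mxyy.
pose G : finZmodType :=
  HB.pack T (GRing.isZmodule.Build T addA addC add0 addN).
(* G repacks T, and its enumeration agrees with that of T only up to proof. *)
have cG : #|G| = #|T|.
  by apply: (@bij_eq_card G T id); exists id.
apply: (@divisible_trivial G) => p pp; rewrite cG => pT {}x.
have [f [fid fcyc fm]] := cyc p pp pT.
apply: (@cyclic_additive_divisible G p f (prime_gt0 pp)) => // v w.
have E : f (fun i => v i + w i)%R = m (f v) (f (fun=> e)) (f w) := fm v _ w.
by rewrite E fid.
Qed.

(** * Sections of a clone *)

(** A quotient D / th as a finite type, with projection q and section s. Its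
    points are canonical representatives, so that it is no larger than A: the
    size bound is what keeps the relevant primes within reach of the cyclic
    operations. *)
Lemma finite_quotient (A : finType) (D : A -> Prop) (th : A -> A -> Prop)
    (e : A) :
  D e -> (forall x, D x -> th x x) -> (forall x y, th x y -> th y x) ->
  (forall x y z, th x y -> th y z -> th x z) ->
  exists (T : finType) (q : A -> T) (s : T -> A),
    [/\ #|T| <= #|A|, forall t, D (s t), forall t, q (s t) = t
      & forall x y, D x -> D y -> (q x = q y <-> th x y)].
Proof.
move=> De thR thS thT.
pose rep x := odflt e [pick z | `[< D z /\ th x z >]].
have repP x : D x -> D (rep x) /\ th x (rep x).
  rewrite /rep; case: pickP => [z /asboolP //|/(_ x)] + Dx.
  by move/asboolP; case; split=> //; apply: thR.
have repE x y : th x y -> rep x = rep y.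
  move=> xy; congr odflt; apply: eq_pick => z /=.
  apply: asbool_equiv_eq; split=> -[Dz xz]; split=> //.
    exact: thT (thS _ _ xy) xz.
  exact: thT xy xz.
have repK x : D x -> rep (rep x) = rep x.
  by move=> Dx; apply/esym/repE; case: (repP x Dx).
pose P x := `[< D x >] && (rep x == x).
have Prep x : D x -> P (rep x).
  by move=> Dx; rewrite /P repK // eqxx andbT; apply/asboolP; case: (repP x Dx).
pose t0 : {x | P x} := Sub (rep e) (Prep e De).
exists {x | P x}, (fun x => insubd t0 (rep x)), val; split=> [||t|x y Dx Dy].
- by rewrite card_sig max_card.
- by case=> x /= /andP[/asboolP].
- by case: t => x Px; apply: val_inj; case/andP: (Px) => _ /eqP rx;
    rewrite val_insubd /= rx Px.
split=> [/(congr1 val)|/repE -> //].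
rewrite !val_insubd ![P _]Prep // => E.
have [_ xr] := repP x Dx; have [_ yr] := repP y Dy.
by apply: thT xr _; rewrite E; apply: thS.
Qed.

Lemma tnth_rot1 (T : Type) (p : nat) (x : p.-tuple T) (i : 'I_p) :
  tnth [tuple of rot 1 x] i = tnth x (ordS i).
Proof.
case: p x i => [|p] x i; first by case: i.
have x0 := tnth x i; rewrite !(tnth_nth x0) /=.
case: x => -[//|a s] sz /=; rewrite rot1_cons nth_rcons.
case/eqP: sz => ss; rewrite ss.
have := ltn_ord i; rewrite ltnS leq_eqVlt => /orP[/eqP ip|ip].
  by rewrite ip ltnn eqxx modnn.
by rewrite ip modn_small.
Qed.

(** All operations of C induce operations on the quotient of D by th, and there
    the one induced by m commutes with the others, itself included. Hence the
    quotient has a single point. *)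
Lemma commuting_section_trivial (n : nat) (C : operation_set n)
    (m : operation n 3) (D : 'I_n -> Prop) (th : 'I_n -> 'I_n -> Prop) :
  idempotent_set C ->
  (forall p, prime p -> p <= n ->
     exists c : operation n p, C p c /\ cyclic_operation c) ->
  C 3 m -> maltsev_operation m ->
  (forall x, D x -> th x x) -> (forall x y, th x y -> th y x) ->
  (forall x y z, th x y -> th y z -> th x z) ->
  (forall k (f : operation n k) (x : k.-tuple 'I_n), 0 < k -> C k f ->
     (forall i, D (tnth x i)) -> D (f x)) ->
  (forall k (f : operation n k) (x y : k.-tuple 'I_n), 0 < k -> C k f ->
     (forall i, th (tnth x i) (tnth y i)) -> th (f x) (f y)) ->
  (forall k (f : operation n k) (x y z : k.-tuple 'I_n), 0 < k -> C k f ->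
     (forall i, [/\ D (tnth x i), D (tnth y i) & D (tnth z i)]) ->
     th (f [tuple m [tuple tnth x i; tnth y i; tnth z i] | i < k])
        (m [tuple f x; f y; f z])) ->
  forall a b, D a -> D b -> th a b.
Proof.
move=> idC cyc Cm malm thR thS thT DC thC comm a b Da Db.
have [T [q [s [cT Ds qs qP]]]] := finite_quotient Da thR thS thT.
apply/(qP _ _ Da Db).
pose ap k (f : operation n k) (x : 'I_k -> T) := q (f [tuple s (x i) | i < k]).
have sq u : D u -> th (s (q u)) u by move=> Du; apply/qP.
have D3 u v w : D u -> D v -> D w -> D (m [tuple u; v; w]).
  by move=> Du Dv Dw; apply: DC => // -[[|[|[|]]]].
have th3 u v w u' v' w' : th u u' -> th v v' -> th w w' ->
    th (m [tuple u; v; w]) (m [tuple u'; v'; w']).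
  by move=> ? ? ?; apply: thC => // -[[|[|[|]]]].
have Dap k (f : operation n k) (x : 'I_k -> T) : 0 < k -> C k f ->
    D (f [tuple s (x i) | i < k]).
  by move=> k0 Cf; apply: DC => // i; rewrite tnth_mktuple.
pose mT u v w := q (m [tuple s u; s v; s w]).
have apm k (f : operation n k) (x y z : 'I_k -> T) : 0 < k -> C k f ->
    ap k f (fun i => mT (x i) (y i) (z i)) =
    mT (ap k f x) (ap k f y) (ap k f z).
  move=> k0 Cf; apply/qP; [exact: Dap|by apply: D3|].
  have h := comm k f [tuple s (x i) | i < k] [tuple s (y i) | i < k]
    [tuple s (z i) | i < k] k0 Cf.
  apply: thT (thT _ _ _ (h _) _) => [|i|].
  - apply: thC => // i; rewrite !tnth_mktuple.
    by apply: sq; apply: D3.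
  - by rewrite !tnth_mktuple; split; apply: Ds.
  by apply: th3; apply/thS/sq/Dap.
have ap3 (x : 'I_3 -> T) : ap 3 m x =
    mT (x (@Ordinal 3 0 isT)) (x (@Ordinal 3 1 isT)) (x (@Ordinal 3 2 isT)).
  congr (q (m _)); apply: eq_from_tnth => i; rewrite tnth_mktuple.
  by case: i => [[|[|[|]]] // i3]; rewrite /tnth /=; congr (s (x _));
    apply: val_inj.
apply: (@commuting_maltsev_cyclic_trivial T mT).
- by move=> x y; rewrite /mT; have [-> _] := malm (s x) (s y).
- by move=> x y; rewrite /mT; have [_ ->] := malm (s x) (s y).
- move=> x1 x2 x3 y1 y2 y3 z1 z2 z3.
  have := apm 3 m (tnth [tuple x1; y1; z1]) (tnth [tuple x2; y2; z2])
    (tnth [tuple x3; y3; z3]) isT Cm.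
  by rewrite !ap3.
move=> p pp pT.
have [c [Cc cc]] : exists c : operation n p, C p c /\ cyclic_operation c.
  by apply: cyc => //; apply: leq_trans pT _; rewrite -[n in _ <= n]card_ord.
exists (ap p c); split=> [x|x|x y z]; last exact: apm (prime_gt0 pp) Cc.
  by rewrite /ap (idC _ (prime_gt0 pp) _ Cc).
rewrite /ap [in RHS]cc; congr (q (c _)); apply: eq_from_tnth => i.
by rewrite tnth_rot1 !tnth_mktuple.
Qed.

(** * Invariant ternary relations *)

Definition invariant3 (n : nat) (C : operation_set n)
    (R : 'I_n -> 'I_n -> 'I_n -> Prop) :=
  forall k (f : operation n k) (x y z : k.-tuple 'I_n), 0 < k -> C k f ->
    (forall i, R (tnth x i) (tnth y i) (tnth z i)) -> R (f x) (f y) (f z).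

(** The choice of D and th is what makes the Mal'cev operation commute with
    the clone: D collects the values found both on row a1 and on column a2,
    and th identifies the values that share a factorization. *)
Lemma invariant3_decomposable (n : nat) (C : operation_set n)
    (R : 'I_n -> 'I_n -> 'I_n -> Prop) (a1 a2 a3 b1 b2 b3 : 'I_n) :
  idempotent_set C ->
  (forall p, prime p -> p <= n ->
     exists c : operation n p, C p c /\ cyclic_operation c) ->
  (exists m : operation n 3, C 3 m /\ maltsev_operation m) ->
  invariant3 C R ->
  R a1 a2 b3 -> R a1 b2 a3 -> R b1 a2 a3 -> R a1 a2 a3.
Proof.
move=> idC cyc [m [Cm malm]] invR R12 R13 R23.
have mR x1 y1 z1 x2 y2 z2 x3 y3 z3 : R x1 y1 z1 -> R x2 y2 z2 -> R x3 y3 z3 ->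
    R (m [tuple x1; x2; x3]) (m [tuple y1; y2; y3]) (m [tuple z1; z2; z3]).
  by move=> ? ? ?; apply: invR => // -[[|[|[|]]]].
have ml x y : m [tuple x; y; y] = x by have [] := malm x y.
have mr x y : m [tuple y; y; x] = x by have [] := malm x y.
pose D z := (exists y, R a1 y z) /\ (exists x, R x a2 z).
pose th z z' := exists x y, R x y z /\ R x y z'.
have fcst k (f : operation n k) c : 0 < k -> C k f ->
    f [tuple c | i < k] = c.
  by move=> k0 Cf; apply: idC.
suff [x [y [Rb Ra]]] : th b3 a3.
  by have := mR _ _ _ _ _ _ _ _ _ R12 Rb Ra; rewrite !ml mr.
apply: (commuting_section_trivial (D := D) idC cyc Cm malm).
- by move=> z [[y Ry] _]; exists a1, y.
- by move=> z z' [x [y [? ?]]]; exists x, y.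
- move=> z z' z'' [x [y [Rz Rz']]] [u [v [Rv Rv']]].
  by exists x, y; split=> //; have := mR _ _ _ _ _ _ _ _ _ Rz' Rv Rv';
    rewrite !ml mr.
- move=> k f z k0 Cf Dz; split.
    have /choice[y Ry] : forall i, exists y, R a1 y (tnth z i).
      by move=> i; case: (Dz i).
    exists (f [tuple y i | i < k]); rewrite -[a1](fcst k f) //.
    by apply: invR => // i; rewrite !tnth_mktuple.
  have /choice[x Rx] : forall i, exists x, R x a2 (tnth z i).
    by move=> i; case: (Dz i).
  exists (f [tuple x i | i < k]); rewrite -[a2](fcst k f) //.
  by apply: invR => // i; rewrite !tnth_mktuple.
- move=> k f z z' k0 Cf zz.
  have /choice[w Rw] : forall i, exists w,
      R w.1 w.2 (tnth z i) /\ R w.1 w.2 (tnth z' i).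
    by move=> i; have [x [y Rxy]] := zz i; exists (x, y).
  exists (f [tuple (w i).1 | i < k]), (f [tuple (w i).2 | i < k]).
  by split; apply: invR => // i; rewrite !tnth_mktuple; case: (Rw i).
- move=> k f z u w k0 Cf Dzuw.
  (* Over (z, u, w), the rectangle with rows x, x' and columns a2, y has corners
     x * a2 = z, x' * a2 = u, x' * y = w, and its fourth corner x * y is
     m(z, u, w) modulo th. The column y exists because x' and a1 share the value u, so
     that row x' takes every value that row a1 takes. *)
  have /choice[g Rg] : forall i, exists g : 'I_n * 'I_n * 'I_n,
      [/\ R g.1.1 a2 (tnth z i), R g.1.2 a2 (tnth u i)
        & R g.1.2 g.2 (tnth w i)].
    move=> i; have [[_ [x Rx]] [[v Rv] [x' Rx']] [[y Ry] _]] := Dzuw i.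
    exists (x, x', m [tuple a2; v; y]); split=> //=.
    by have := mR _ _ _ _ _ _ _ _ _ Rx' Rv Ry; rewrite ml mr.
  pose x := [tuple (g i).1.1 | i < k]; pose x' := [tuple (g i).1.2 | i < k].
  pose y := [tuple (g i).2 | i < k].
  (* f applied to the fourth corners, and the fourth corner of the rectangle
     obtained by applying f to the other three, both sit at (f x, f y). *)
  exists (f x), (f y); split.
    apply: invR => // i; rewrite !tnth_mktuple; have [Rz Ru Rw] := Rg i.
    by have := mR _ _ _ _ _ _ _ _ _ Rz Ru Rw; rewrite ml mr.
  rewrite -(ml (f x) (f x')) -(mr (f y) a2); apply: mR.
  + rewrite -[a2](fcst k f) //; apply: invR => // i.
    by rewrite !tnth_mktuple; case: (Rg i).
  + rewrite -[a2](fcst k f) //; apply: invR => // i.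
    by rewrite !tnth_mktuple; case: (Rg i).
  by apply: invR => // i; rewrite !tnth_mktuple; case: (Rg i).
- by split; [exists a2|exists a1].
- by split; [exists b2|exists b1].
Qed.

(** * Interpolation *)

(** Baker-Pixley, by induction on the number of prescriptions. Given at least
    three of them, p, q, r and the rest L, the values at p, q, r of operations
    correct on L form a relation R. It is invariant because idempotent operations
    preserve correctness on L, and it contains the three triples obtained by
    neglecting p, q or r in turn. *)
Lemma interpolation (n : nat) (C : operation_set n) (k : nat)
    (L : seq (k.-tuple 'I_n * 'I_n)) :
  is_clone C -> idempotent_set C ->
  (forall (R : 'I_n -> 'I_n -> 'I_n -> Prop) a1 a2 a3 b1 b2 b3,
     invariant3 C R ->
     R a1 a2 b3 -> R a1 b2 a3 -> R b1 a2 a3 -> R a1 a2 a3) ->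
  0 < k ->
  {in L &, forall p q, exists t : operation n k,
     [/\ C k t, t p.1 = p.2 & t q.1 = q.2]} ->
  exists t : operation n k, C k t /\ {in L, forall p, t p.1 = p.2}.
Proof.
move=> cloC idC dec k0.
have [N] := ubnP (size L); elim: N L => // N IH [|p [|q [|r L]]] szL tL.
- by exists (projection n (Ordinal k0)); split=> //; apply: clone_projection.
- have [t [Ct tp _]] := tL p p (mem_head _ _) (mem_head _ _).
  by exists t; split=> // p'; rewrite inE => /eqP->.
- have [||t [Ct tp tq]] := tL p q; rewrite ?inE ?eqxx ?orbT //.
  by exists t; split=> // p'; rewrite !inE => /orP[] /eqP->.
pose R a b c := exists t : operation n k,
  [/\ C k t, {in L, forall p', t p'.1 = p'.2}
    & [/\ t p.1 = a, t q.1 = b & t r.1 = c]].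
have invR : invariant3 C R.
  move=> l f x y z l0 Cf /choice[t Rt].
  have E p' : composition f t p'= f [tuple t i p' | i < l] by rewrite ffunE.
  exists (composition f t); split.
  - by apply: clone_composition => // i; case: (Rt i).
  - move=> p' Lp'; rewrite E -[RHS](idC l l0 f Cf); congr (f _).
    apply: eq_from_tnth => i; rewrite !tnth_mktuple.
    by have [_ ->] := Rt i.
  by split; rewrite E; congr (f _); apply: eq_from_tnth => i;
    rewrite tnth_mktuple; have [_ _ []] := Rt i.
have sub L' : size L' < N -> {subset L' <= [:: p, q, r & L]} ->
    exists t : operation n k, C k t /\ {in L', forall p, t p.1 = p.2}.
  by move=> szL' sL; apply: IH => // p' q' /sL Lp' /sL Lq'; apply: tL.
have [||t1 [Ct1 tL1]] := sub [:: q, r & L]; first by [].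
  by move=> p' Lp'; rewrite inE Lp' orbT.
have [||t2 [Ct2 tL2]] := sub [:: p, r & L]; first by [].
  by move=> p'; rewrite !inE => /or3P[]->; rewrite ?orbT.
have [||t3 [Ct3 tL3]] := sub [:: p, q & L]; first by [].
  by move=> p'; rewrite !inE => /or3P[]->; rewrite ?orbT.
have [t [Ct tL0 [tp tq tr]]] : R p.2 q.2 r.2.
  apply: (dec R _ _ _ (t1 p.1) (t2 q.1) (t3 r.1)) => //.
  - exists t3; split=> // [p' Lp'|]; first by apply: tL3; rewrite !inE Lp' !orbT.
    by split=> //; apply: tL3; rewrite !inE eqxx ?orbT.
  - exists t2; split=> // [p' Lp'|]; first by apply: tL2; rewrite !inE Lp' !orbT.
    by split=> //; apply: tL2; rewrite !inE eqxx ?orbT.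
  exists t1; split=> // [p' Lp'|]; first by apply: tL1; rewrite !inE Lp' !orbT.
  by split=> //; apply: tL1; rewrite !inE eqxx ?orbT.
exists t; split=> // p'; rewrite !inE => /or4P[/eqP->|/eqP->|/eqP->|] //.
exact: tL0.
Qed.

Theorem lemma3p4 (n : nat) (C : operation_set n) :
  2 <= n ->
  is_clone C ->
  idempotent_set C ->
  (forall p : nat, prime p -> p <= n ->
     exists c : operation n p, C p c /\ cyclic_operation c) ->
  (exists m : operation n 3, C 3 m /\ maltsev_operation m) ->
  exists f : operation n 3, C 3 f /\ majority_operation f.
Proof.
move=> _ cloC idC cyc mal.
(* The constraint p = (v, y) is met by every projection other than the i-th. *)
pose nearly (p : 3.-tuple 'I_n * 'I_n) (i : 'I_3) :=
  [forall j, (j != i) ==> (tnth p.1 j == p.2)].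
have [||f [Cf fE]] := @interpolation n C 3
    (enum [pred p | [exists i, nearly p i]]) cloC idC _ isT.
- by move=> R a1 a2 a3 b1 b2 b3; apply: invariant3_decomposable.
- move=> p q; rewrite !mem_enum => /existsP[i pi] /existsP[j qj].
  have [l li lj] : exists2 l : 'I_3, l != i & l != j.
    have : 0 < #|~: [set i; j]|.
      by rewrite cardsCs setCK card_ord cards2; case: (i != j).
    by case/card_gt0P=> l; rewrite !inE negb_or => /andP[]; exists l.
  exists (projection n l); split; rewrite ?ffunE.
  - exact: clone_projection.
  - by apply/eqP; have /forallP/(_ l)/implyP := pi; apply.
  - by apply/eqP; have /forallP/(_ l)/implyP := qj; apply.
exists f; split=> // x y.
have fy t i : nearly (t, y) i -> f t = y.
  by move=> ti; apply: (fE (t, y)); rewrite mem_enum; apply/existsP; exists i.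
by split; [apply: (fy _ (@Ordinal 3 0 isT))|apply: (fy _ (@Ordinal 3 1 isT))|
  apply: (fy _ (@Ordinal 3 2 isT))];
  apply/forallP => -[[|[|[|]]]] // ?; apply/implyP => //= _; apply/eqP.
Qed.
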